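(* Let $\mathbb{K}_{2,\omega}$ be the graph with vertex set $K_{2,\omega}=A_{+1}\sqcup A_{-1}$, where $A_{+1},A_{-1}$ are disjoint countably infinite sets, and edge relation $E=A_{-1}\times A_{+1}\cup A_{+1}\times A_{-1}$. Let $\mathbb{G}$ be the structure with domain $G=\mathbb{N}\times K_{2,\omega}$ and two binary relations $E_1=\{((i,x),(j,y))\in G^2: i\neq j\}$ and $E_2=\{((i,x),(j,y))\in G^2: i=j,\ (x,y)\in E\}$. Then on the endomorphism monoid $\mathrm{End}(\mathbb{G})$, the topology of pointwise convergence is strictly finer than the Zariski topology.
   Context: $\mathrm{End}(\mathbb{G})$ is the monoid of maps $G\to G$ preserving $E_1$ and $E_2$, under composition. The topology of pointwise convergence is the subspace topology inherited from the product topology on $G^G$ with each factor discrete. For a monoid $S$, the Zariski topology is generated by all sets $M_{\varphi,\psi}=\{s\in S:\varphi(s)\neq\psi(s)\}$, where $\ell\le k$ are natural numbers, $p_0,\dots,p_k,q_0,\dots,q_\ell\in S$, $\varphi(s)=p_k s p_{k-1}s\cdots s p_0$, $\psi(s)=q_\ell s q_{\ell-1}s\cdots s q_0$ (if $\ell=0$, $\psi(s)=q_0$). *)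

(* Defs.v *)
From HB Require Import structures.
From mathcomp Require Import all_boot.
From mathcomp Require Import all_classical.
From mathcomp Require Import topology_structure initial_topology.
From mathcomp Require Import discrete_topology function_spaces.

Set Implicit Arguments.
Unset Strict Implicit.
Unset Printing Implicit Defensive.

Local Open Scope classical_set_scope.

Record endo (T : Type) (E1 E2 : rel T) := Endo {
  endo_fun :> T -> T;
  endo_homo1 : {homo endo_fun : x y / E1 x y};
  endo_homo2 : {homo endo_fun : x y / E2 x y}
}.

Section EndoMonoid.
Context (T : Type) (E1 E2 : rel T).
Local Notation End := (endo E1 E2).

Lemma endoP (f g : End) : f =1 g -> f = g.
Proof.
case: f g => [f f1 f2] [g g1 g2] /= fg.
have eqfg : f = g by exact/funext.
by subst g; congr Endo; exact: Prop_irrelevance.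
Qed.

Definition endo_one : End :=
  @Endo T E1 E2 id (fun _ _ h => h) (fun _ _ h => h).

Definition endo_mul (f g : End) : End :=
  @Endo T E1 E2 (f \o g)
    (fun _ _ h => endo_homo1 f (endo_homo1 g h))
    (fun _ _ h => endo_homo2 f (endo_homo2 g h)).

Lemma endo_mulA : associative endo_mul.
Proof. by move=> f g h; exact: endoP. Qed.

Lemma endo_mul1 : left_id endo_one endo_mul.
Proof. by move=> f; exact: endoP. Qed.

Lemma endo_mulr1 : right_id endo_one endo_mul.
Proof. by move=> f; exact: endoP. Qed.

HB.instance Definition _ := gen_eqMixin End.
HB.instance Definition _ := gen_choiceMixin End.
HB.instance Definition _ :=
  isMonoid.Build End endo_mulA endo_mul1 endo_mulr1.

End EndoMonoid.

Definition pointwise_topology (T : choiceType) (E1 E2 : rel T) :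
    topologicalType :=
  @initial_topology (endo E1 E2) {ptws T -> discrete_topology T}
    (@endo_fun T E1 E2).

Definition pointwise_open (T : choiceType) (E1 E2 : rel T) :
    set_system (endo E1 E2) :=
  @open (pointwise_topology E1 E2).

Arguments pointwise_open {T} E1 E2.

(* [zariski_word p k s] is p_k s p_{k-1} s ... s p_0; only the values
   p 0, ..., p k of the sequence p are used. *)
Fixpoint zariski_word (S : monoidType) (p : nat -> S) (k : nat) (s : S) : S :=
  if k is k'.+1 then (p k * s * zariski_word p k' s)%g else p 0.

Definition zariski_subbase (S : monoidType) : set_system S :=
  [set M | exists k l (p q : nat -> S), (l <= k)%N /\
     M = [set s | zariski_word p k s <> zariski_word q l s]].

Definition zariski_topology (S : monoidType) : Type := S.

HB.instance Definition _ (S : monoidType) := Choice.on (zariski_topology S).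
HB.instance Definition _ (S : monoidType) :=
  isSubBaseTopological.Build (zariski_topology S) (@zariski_subbase S) id.

Definition zariski_open (S : monoidType) : set_system S :=
  @open (zariski_topology S).

Arguments zariski_open S : clear implicits.

Section Structure.
Context (Ap Am : choiceType).

(* A_{+1} is Ap and A_{-1} is Am; the sum type makes their union disjoint. *)
Definition K2w : choiceType := (Ap + Am)%type.

Definition K2w_edge : rel K2w := fun x y =>
  match x, y with
  | inl _, inr _ | inr _, inl _ => true
  | inl _, inl _ | inr _, inr _ => false
  end.

Definition G_dom : choiceType := (nat * K2w)%type.

Definition G_E1 : rel G_dom := fun u v => u.1 != v.1.

Definition G_E2 : rel G_dom := fun u v => (u.1 == v.1) && K2w_edge u.2 v.2.

End Structure.

Arguments G_E1 Ap Am : clear implicits.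
Arguments G_E2 Ap Am : clear implicits.

(* Main.v *)
(* An endomorphism maps copies of K_{2,omega} injectively to copies and on each
   copy either preserves or exchanges the two sides. Let s_0 retract every copy
   onto one edge, and for e : nat -> bool let s_e be s_0 followed by the
   exchange of the two ends of that edge in each copy n with e n. We show that
   {s | s fixes one end of the edge in copy 0} is no Zariski neighbourhood of
   s_0: every M_{phi,psi} containing s_0 contains s_e for all e that are true
   on a suitable finite set and otherwise generic. If phi and psi contain s
   equally often modulo 2, exchanging the ends on all copies visited by a
   witness of phi(s_0) <> psi(s_0) only exchanges the sides of the argument.
   Otherwise the copies visited from a copy n far out are all fresh, and
   exchanging the ends on all of them or on none changes the relative side of
   phi(s)(n, _) and psi(s)(n, _). *)
Require Import Defs.
From mathcomp Require Import all_boot all_classical.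
From mathcomp Require Import topology_structure initial_topology.
From mathcomp Require Import discrete_topology function_spaces.

Set Implicit Arguments.
Unset Strict Implicit.
Unset Printing Implicit Defensive.

Local Open Scope classical_set_scope.

(** Open sets are unions of finite intersections of subbasic sets. *)
Lemma zariski_open_ind (S : monoidType) (P : set_system S) :
  P [set: S] -> setI_closed P ->
  (forall F : set_system S, F `<=` P -> P (\bigcup_(A in F) A)) ->
  @zariski_subbase S `<=` P -> zariski_open S `<=` P.
Proof.
move=> PT PI PU Pb _ [D sDb <-]; apply: PU => _ /sDb [X sXb <-].
rewrite bigcap_fset big_seq; apply: big_ind => // A AX.
by apply: Pb; have := sXb A AX; rewrite inE.
Qed.

(** * Zariski open sets are pointwise open *)

Section PointwiseTopology.
Context (T : choiceType) (E1 E2 : rel T).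
Implicit Types (u : T) (A : set T) (p q : nat -> endo E1 E2).

Lemma pointwise_open_eval u A :
  pointwise_open E1 E2 [set f | A (f u)].
Proof.
exists (@proj T (fun=> discrete_topology T) u @^-1` A) => //.
apply: open_comp; first by move=> f _; exact: proj_continuous.
exact: discrete_open.
Qed.

Lemma pointwise_open_word p k u A :
  pointwise_open E1 E2 [set f | A (zariski_word p k f u)].
Proof.
elim: k A => [|k IHk] A /=.
  have [Au|nAu] := pselect (A (p 0 u)).
    rewrite (_ : [set _ | _] = setT); first exact: (@openT (pointwise_topology E1 E2)).
    by apply/seteqP; split.
  rewrite (_ : [set _ | _] = set0); first exact: (@open0 (pointwise_topology E1 E2)).
  by apply/seteqP; split.
(* Once the value [v] of the shorter word is fixed, only a condition on [f v] remains. *)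
rewrite (_ : [set _ | _] = \bigcup_v ([set f | [set v] (zariski_word p k f u)]
    `&` [set f | (p k.+1 @^-1` A) (f v)])).
  apply: (@bigcup_open (pointwise_topology E1 E2)) => v _.
  apply: (@openI (pointwise_topology E1 E2)); first exact: IHk.
  exact: pointwise_open_eval.
apply/seteqP; split=> f /=.
  by move=> Af; exists (zariski_word p k f u).
by case=> v _ [/= <-].
Qed.

Lemma zariski_sub_pointwise :
  zariski_open (endo E1 E2) `<=` pointwise_open E1 E2.
Proof.
apply: zariski_open_ind.
- exact: (@openT (pointwise_topology E1 E2)).
- move=> A B; exact: (@openI (pointwise_topology E1 E2)).
- move=> F FP; exact: (@bigcup_open (pointwise_topology E1 E2)).
move=> _ [k [l [p [q [_ ->]]]]].
rewrite (_ : [set _ | _] = \bigcup_u \bigcup_v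
    ([set f | [set v] (zariski_word p k f u)]
     `&` [set f | (~` [set v]) (zariski_word q l f u)])).
  apply: (@bigcup_open (pointwise_topology E1 E2)) => u _.
  apply: (@bigcup_open (pointwise_topology E1 E2)) => v _.
  by apply: (@openI (pointwise_topology E1 E2)); exact: pointwise_open_word.
apply/seteqP; split=> f /=.
  move=> neq; apply: contrapT => eqw; apply/neq/endoP => u.
  apply: contrapT => nequ; apply: eqw; exists u => //.
  exists (zariski_word p k f u) => //; split=> //= /esym; exact: nequ.
by case=> u _ [v _ [/= <- +]] eqw; apply; rewrite eqw.
Qed.

End PointwiseTopology.

(** * Endomorphisms, copies and sides *)

Section Twists.
Context (Ap Am : choiceType) (a : Ap) (b : Am).
Local Notation G := (G_dom Ap Am).
Local Notation End := (endo (G_E1 Ap Am) (G_E2 Ap Am)).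
Implicit Types (f : End) (p q : nat -> End) (e : nat -> bool) (u v : G).

Definition side (x : K2w Ap Am) : bool := if x is inl _ then true else false.

Lemma K2w_edgeE (x y : K2w Ap Am) : K2w_edge x y = side x (+) side y.
Proof. by case: x y => [?|?] [?|?]. Qed.

Definition side_repr (c : bool) : K2w Ap Am := if c then inl a else inr b.

Lemma side_reprK : cancel side_repr side.
Proof. by case. Qed.

Lemma endo_copy_inj f u v : (f u).1 = (f v).1 -> u.1 = v.1.
Proof.
move=> fuv; apply/eqP; apply: contraT => uv.
by have := endo_homo1 f (uv : G_E1 Ap Am u v); rewrite /G_E1 fuv eqxx.
Qed.

Lemma endo_edge f u v : u.1 = v.1 -> side u.2 (+) side v.2 ->
  (f u).1 = (f v).1 /\ side (f u).2 (+) side (f v).2.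
Proof.
move=> uv1 uv2; have : G_E2 Ap Am u v by rewrite /G_E2 uv1 eqxx K2w_edgeE.
by move=> /(endo_homo2 f) /andP[/eqP ? +]; rewrite K2w_edgeE.
Qed.

Lemma endo_copy_side f u v : u.1 = v.1 ->
  (f u).1 = (f v).1 /\
  side (f u).2 (+) side (f v).2 = side u.2 (+) side v.2.
Proof.
move=> uv1; have [uv2|] := boolP (side u.2 (+) side v.2).
  by have [-> ->] := endo_edge f uv1 uv2.
(* Here [u] and [v] lie on the same side, and [w] is a common neighbour. *)
move=> /negbTE uv2; pose w : G := (u.1, side_repr (~~ side u.2)).
have uw : side u.2 (+) side w.2 by rewrite side_reprK addbN addbb.
have vw : side v.2 (+) side w.2.
  by move: uw uv2; case: (side u.2); case: (side v.2).
have [-> fuw] := endo_edge f (erefl : u.1 = w.1) uw.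
have [-> fvw] := endo_edge f (esym uv1 : v.1 = w.1) vw.
split=> //; move: fuw fvw.
by case: (side (f u).2); case: (side (f v).2); case: (side (f w).2).
Qed.

Lemma endo_copy f u v : u.1 = v.1 -> (f u).1 = (f v).1.
Proof. by move=> /(endo_copy_side f)[]. Qed.

Lemma endo_side f u v : u.1 = v.1 ->
  side (f u).2 = side (f v).2 (+) (side u.2 (+) side v.2).
Proof. by move=> /(endo_copy_side f)[_ <-]; rewrite addbC addbK. Qed.

(** This is s_e; the chosen edge of each copy joins [a] and [b]. *)
Definition twist_fun e u : G := (u.1, side_repr (side u.2 (+) e u.1)).

Lemma twist_homo1 e : {homo twist_fun e : u v / G_E1 Ap Am u v}.
Proof. by []. Qed.

Lemma twist_homo2 e : {homo twist_fun e : u v / G_E2 Ap Am u v}.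
Proof.
move=> u v; rewrite /G_E2 !K2w_edgeE /= !side_reprK => /andP[/eqP -> uv].
by rewrite eqxx addbACA addbb addbF.
Qed.

Definition twist e : End := Endo (twist_homo1 e) (twist_homo2 e).

(** * Words evaluated at twists *)

Lemma twist_eq e e' u v : u.1 = v.1 ->
  side u.2 (+) e u.1 = side v.2 (+) e' v.1 -> twist e u = twist e' v.
Proof. by move=> uv1 uv2; rewrite /= /twist_fun uv2 uv1. Qed.

(** Twists fix every copy, so the copies visited do not depend on the twist. *)
Lemma word_copy p k e e' u v : u.1 = v.1 ->
  (zariski_word p k (twist e) u).1 = (zariski_word p k (twist e') v).1.
Proof.
move=> uv; elim: k => [|k IHk] /=; first exact: endo_copy.
exact: endo_copy.
Qed.

(* The value of a word at copy [n] only depends on the twists of the copies it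
   visits. *)
Lemma word_local p k n : exists N, forall e e',
  (forall m, m < N -> e m = e' m) -> forall x,
  zariski_word p k (twist e) (n, x) = zariski_word p k (twist e') (n, x).
Proof.
elim: k => [|k [N IHk]] /=; first by exists 0.
(* The copy on which the last twist acts; by [word_copy] it may be computed at [xpred0] and at any
   vertex of copy [n]. *)
pose m := (zariski_word p k (twist xpred0) (n, side_repr true)).1.
exists (maxn N m.+1) => e e' ee' x /=.
rewrite (IHk e e') => [|i iN]; last by apply: ee'; rewrite leq_max iN.
congr (p _ _); apply: twist_eq => //; congr (_ (+) _); apply: ee'.
by rewrite (@word_copy _ _ _ xpred0 _ (n, side_repr true)) // leq_max ltnSn orbT.
Qed.

Lemma injective_unbounded (g : nat -> nat) N : injective g ->
  exists B, forall n, B <= n -> N <= g n.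
Proof.
move=> ginj; elim: N => [|N [B IHN]]; first by exists 0.
have [[n0 gn0]|noN] := pselect (exists n, g n = N).
  (* Injectivity leaves [n0] as the only argument with value [N]. *)
  exists (maxn B n0.+1) => n; rewrite geq_max => /andP[/IHN].
  rewrite leq_eqVlt => /predU1P[gn|//].
  by rewrite (_ : n = n0) ?ltnn //; apply: ginj; rewrite -gn.
exists B => n /IHN; rewrite leq_eqVlt => /predU1P[gn|//].
by case: noN; exists n.
Qed.

(* The copies visited from copy [n] tend to infinity with [n]. *)
Lemma word_escape p k N : exists B, forall n, B <= n -> forall e e',
  (forall m, N <= m -> e m = e' m) -> forall x,
  zariski_word p k (twist e) (n, x) = zariski_word p k (twist e') (n, x).
Proof.
elim: k => [|k [B IHk]] /=; first by exists 0.
pose g n := (zariski_word p k (twist xpred0) (n, side_repr true)).1.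
(* A word is itself an endomorphism, hence keeps distinct copies apart. *)
have ginj : injective g by move=> n m /endo_copy_inj.
have [C gC] := injective_unbounded N ginj.
exists (maxn B C) => n; rewrite geq_max => /andP[Bn Cn] e e' ee' x /=.
rewrite (IHk _ Bn e e') //; congr (p _ _); apply: twist_eq => //.
congr (_ (+) _); apply: ee'.
rewrite (@word_copy _ _ _ xpred0 _ (n, side_repr true)) //; exact: gC.
Qed.

(** Each of the [k] letters contributes one flip, and the coefficients pass every flip on. *)
Lemma word_side p k u :
  side (zariski_word p k (twist xpredT) u).2 =
  side (zariski_word p k (twist xpred0) u).2 (+) odd k.
Proof.
elim: k => [|k IHk] /=; first by rewrite addbF.
set v := zariski_word p k _ u; set w := zariski_word p k _ u.
have vw : v.1 = w.1 by exact: word_copy.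
rewrite (@endo_side _ _ (twist xpred0 w)) //; congr (_ (+) _).
by rewrite /= !side_reprK IHk -/w; case: side; case: odd.
Qed.

(* Twisting every copy has the same effect on a word with an odd number of
   letters [s] as exchanging the two sides of the argument. *)
Lemma word_twist p k n x :
  let y := if odd k then side_repr (~~ side x) else x in
  zariski_word p k (twist xpredT) (n, y) =
  zariski_word p k (twist xpred0) (n, x).
Proof.
case: k => [|k] //=; congr (p _ _).
set y := (if _ then _ else _).
have vw := @word_copy p k xpredT xpred0 (n, y) (n, x) erefl.
(* Only sides matter now: the flips [odd k] of the inner word, one of the last letter and [odd k.+1]
   of the argument cancel. *)
apply: twist_eq => //; rewrite word_side.
rewrite (@endo_side (zariski_word p k (twist xpred0)) (n, y) (n, x)) //=.
rewrite /y; case: (odd k) => /=; rewrite ?side_reprK;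
  by case: (side x); case: (side _).
Qed.

(** * Genericity of Zariski neighbourhoods of s_0 *)

(* Read [e] as a point of Cantor space: near the point [xpredT] the set
   of those [e] with [twist e] in [O] contains a dense open set. *)
Definition generic_twist (O : set End) : Prop :=
  O (twist xpred0) -> exists N, forall e N0, N <= N0 ->
    (forall m, m < N -> e m) ->
  exists e1 N1, [/\ N0 <= N1, forall m, m < N0 -> e1 m = e m &
    forall e', (forall m, m < N1 -> e' m = e1 m) -> O (twist e')].

(** As for dense open sets: the extension for [B] starts from the one found for [A]. *)
Lemma generic_twistI : setI_closed generic_twist.
Proof.
move=> A B gA gB [/gA[NA {}gA] /gB[NB {}gB]].
exists (maxn NA NB) => e N0; rewrite geq_max => /andP[A0 B0] eT.
have [|e1 [N1 [N01 e1e Ae1]]] := gA e N0 A0.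
  by move=> m mA; apply: eT; rewrite leq_max mA.
have [||e2 [N2 [N12 e2e Be2]]] := gB e1 N1; first exact: leq_trans N01.
  move=> m mB; rewrite e1e; last exact: leq_trans B0.
  by apply: eT; rewrite leq_max mB orbT.
exists e2, N2; split; first exact: leq_trans N12.
  by move=> m m0; rewrite e2e ?e1e //; exact: leq_trans N01.
move=> e' e'e2; split; last exact: Be2.
apply: Ae1 => m m1; rewrite e'e2 ?e2e //; exact: leq_trans N12.
Qed.

Lemma generic_twist_bigcup (F : set (set End)) :
  F `<=` generic_twist -> generic_twist (\bigcup_(A in F) A).
Proof.
move=> gF [A FA /(gF _ FA)[N gA]]; exists N => e N0 N0N eT.
have [e1 [N1 [N01 e1e Ae1]]] := gA e N0 N0N eT.
by exists e1, N1; split=> // e' e'e1; exists A => //; exact: Ae1.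
Qed.

Lemma generic_twist_even p q k l : odd k = odd l ->
  generic_twist [set s | zariski_word p k s <> zariski_word q l s].
Proof.
move=> kl /= neq.
have [[n x] nequ] : exists u, zariski_word p k (twist xpred0) u <>
    zariski_word q l (twist xpred0) u.
  apply: contrapT => eqw; apply/neq/endoP => u.
  by apply: contrapT => nequ; apply: eqw; exists u.
have [Np locp] := word_local p k n; have [Nq locq] := word_local q l n.
exists (maxn Np Nq) => e N0; rewrite geq_max => /andP[Np0 Nq0] eT.
exists e, N0; split=> // e' e'e eqe'; apply: nequ.
have e'T m : m < maxn Np Nq -> e' m = true.
  move=> mN; rewrite e'e; first exact: eT.
  by apply: leq_trans mN _; rewrite geq_max Np0.
(* Equal parities make [word_twist] move both words to the same vertex. *)
rewrite -!word_twist -kl -(locp e') => [|m mN]; last first.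
  by apply: e'T; rewrite leq_max mN.
rewrite -(locq e') => [|m mN]; first by rewrite eqe'.
by apply: e'T; rewrite leq_max mN orbT.
Qed.

Lemma generic_twist_odd p q k l : odd k <> odd l ->
  generic_twist [set s | zariski_word p k s <> zariski_word q l s].
Proof.
move=> kl _; exists 0 => e N0 _ _.
have [Bp escp] := word_escape p k N0; have [Bq escq] := word_escape q l N0.
pose n := maxn Bp Bq; pose u : G := (n, side_repr true).
(* From [xpred0] to [xpredT] the two values flip by [odd k] and [odd l], so they cannot agree both
   times. *)
have [c neqc] : exists c : bool, zariski_word p k (twist (fun=> c)) u <>
    zariski_word q l (twist (fun=> c)) u.
  have [eq0|] := pselect (zariski_word p k (twist xpred0) u =
    zariski_word q l (twist xpred0) u); last by exists false.
  exists true => eqT; apply: kl.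
  have := word_side p k u; rewrite eqT word_side eq0.
  by case: side; case: (odd k); case: (odd l).
pose e1 m := if m < N0 then e m else c.
have e1c m : N0 <= m -> e1 m = c by rewrite /e1 leqNgt => /negbTE ->.
have [Np locp] := word_local p k n; have [Nq locq] := word_local q l n.
exists e1, (maxn N0 (maxn Np Nq)); split; first by rewrite leq_maxl.
  by rewrite /e1 => m ->.
move=> e' e'e1 eqe'; apply: neqc.
(* From copy [n] on, only copies beyond [N0] matter, where [e1] is constantly [c]. *)
rewrite -(escp n _ e1) ?leq_maxl // -(escq n _ e1) ?leq_maxr //.
rewrite -(locp e') => [|m mN]; last by apply: e'e1; rewrite !leq_max mN orbT.
rewrite -(locq e') => [|m mN]; last by apply: e'e1; rewrite !leq_max mN !orbT.
by rewrite eqe'.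
Qed.

Lemma zariski_open_generic : zariski_open End `<=` generic_twist.
Proof.
apply: zariski_open_ind; first by move=> _; exists 0 => e N0 _ _; exists e, N0.
- exact: generic_twistI.
- exact: generic_twist_bigcup.
move=> _ [k [l [p [q [_ ->]]]]].
have [/eqP kl|/eqP kl] := boolP (odd k == odd l).
  exact: generic_twist_even.
exact: generic_twist_odd.
Qed.

Lemma pointwise_not_zariski :
  ~ pointwise_open (G_E1 Ap Am) (G_E2 Ap Am) `<=` zariski_open End.
Proof.
move=> sub; pose u : G := (0, side_repr true).
have /sub/zariski_open_generic := @pointwise_open_eval _
  (G_E1 Ap Am) (G_E2 Ap Am) u [set u].
(* The bound [N.+1] is positive, so [e1 0] is true and [twist e1] moves [u]. *)
case=> [//|N] /(_ xpredT N.+1 (leqnSn N)) [//|e1 [N1 [N01 e1T Ue1]]].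
have := Ue1 e1 (fun _ _ => erefl).
by rewrite /= /twist_fun /= e1T.
Qed.

End Twists.

Theorem theorem4p9 (Ap Am : choiceType)
    (hAp : ([set: Ap] #= [set: nat])%card)
    (hAm : ([set: Am] #= [set: nat])%card) :
  zariski_open (endo (G_E1 Ap Am) (G_E2 Ap Am))
    `<` pointwise_open (G_E1 Ap Am) (G_E2 Ap Am).
Proof.
have inhabited (A : choiceType) : ([set: A] #= [set: nat])%card -> A.
  move=> cardA; have [A0|/set0P/cid[x _]] := eqVneq [set: A] set0; last exact: x.
  exfalso; move: cardA; rewrite A0 card_eq_sym card_eq0 => /eqP nat0.
  by have : [set: nat] 0 by []; rewrite nat0.
split; first exact: zariski_sub_pointwise.
exact: pointwise_not_zariski (inhabited _ hAp) (inhabited _ hAm).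
Qed.
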